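(* Let $X$ be a complete separable Riemannian manifold and $Y$ a Polish space, equipped with Borel probability measures $\mu$ on $X$ and $\nu$ on $Y$. Let $c : X \times Y \to \mathbb{R}$ be a bounded continuous cost function and let $m\in\mathbb{N}$. Assume that: (1) $c$ satisfies the $m$-twist condition; (2) $\mu$ is non-atomic and any $c$-concave function is differentiable $\mu$-almost surely on its domain. Then for each optimal plan $\gamma$ of the Kantorovich problem $\inf\{\int_{X\times Y} c\,d\pi : \pi\in\Pi(\mu,\nu)\}$, there exist $k\in\{1,\dots,m\}$, a sequence $\{\alpha_i\}_{i=1}^k$ of non-negative measurable functions from $X$ to $[0,1]$, and Borel measurable maps $G_1,\dots,G_k$ from $X$ to $Y$ such that $$\gamma=\sum_{i=1}^k \alpha_i\,(\mathrm{Id}\times G_i)_\#\mu,$$ where $\sum_{i=1}^k\alpha_i(x)=1$ for $\mu$-almost every $x\in X$.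
   Context: $\Pi(\mu,\nu)$ is the set of Borel probability measures on $X\times Y$ with marginals $\mu$ and $\nu$. An optimal plan is a $\gamma\in\Pi(\mu,\nu)$ attaining $\inf\{\int_{X\times Y} c\,d\pi : \pi\in\Pi(\mu,\nu)\}$. $m$-twist condition: $x\mapsto c(x,y)$ is differentiable for all $y\in Y$, and for any $x_0\in X$, $y_0\in Y$ the set $\{y\in Y : \frac{\partial c(x_0,y)}{\partial x}=\frac{\partial c(x_0,y_0)}{\partial x}\}$ has cardinality at most $m$. A function $\varphi:X\to\mathbb{R}\cup\{-\infty\}$, not identically $-\infty$, is $c$-concave if $\varphi(x)=\inf_{y\in Y}[c(x,y)-\psi(y)]$ for some $\psi:Y\to\mathbb{R}\cup\{\pm\infty\}$; its domain is the set where it is finite. The notation $\gamma=\sum_{i=1}^k \alpha_i(\mathrm{Id}\times G_i)_\#\mu$ means that $\gamma(S)=\sum_{i=1}^k\int_X\alpha_i(x)\chi_S(x,G_i(x))\,d\mu(x)$ for every measurable $S\subset X\times Y$, where $\chi_S$ is the indicator function of $S$. *)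

(* Defs.v *)
From HB Require Import structures.
From mathcomp Require Import all_boot all_order all_algebra.
From mathcomp Require Import all_classical all_reals all_analysis.

Set Implicit Arguments.
Unset Strict Implicit.
Unset Printing Implicit Defensive.

Import Order.TTheory GRing.Theory Num.Theory.
Import numFieldNormedType.Exports.

Local Open Scope classical_set_scope.
Local Open Scope ring_scope.

Section topology.
Context {R : realType} {T : topologicalType}.

Definition separable := exists2 D : set T, countable D & dense D.

(* Distances are extended-real valued: the Riemannian distance between two
   connected components is +oo. *)
Definition cauchy_sequence (d : T -> T -> \bar R) (u : nat -> T) :=
  forall e : R, 0 < e ->
    exists N, forall p q, (N <= p)%N -> (N <= q)%N -> (d (u p) (u q) < e%:E)%E.

Definition complete_distance (d : T -> T -> \bar R) :=
  forall u : nat -> T, cauchy_sequence d u -> exists l : T, u @ \oo --> l.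

Definition is_metric (d : T -> T -> R) :=
  [/\ forall x y, 0 <= d x y,
      forall x y, d x y = 0 <-> x = y,
      forall x y, d x y = d y x &
      forall x y z, d x z <= d x y + d y z].

Definition metrizes_topology (d : T -> T -> R) :=
  forall (x : T) (A : set T),
    nbhs x A <-> exists2 e : R, 0 < e & [set y | d x y < e] `<=` A.

End topology.

Arguments separable : clear implicits.

Definition polish_space (R : realType) (T : topologicalType) :=
  separable T /\
  exists d : T -> T -> R,
    [/\ is_metric d, metrizes_topology d &
        complete_distance (fun x y => (d x y)%:E)].

Notation borel T := (g_sigma_algebraType (@open T)).

Section smooth_maps.
Context {R : realType} {V W : normedModType R}.

Fixpoint Ck_on (k : nat) (U : set V) (f : V -> W) : Prop :=
  match k with
  | 0 => {in U, continuous f}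
  | k'.+1 => (forall x, U x -> differentiable f x) /\
             (forall v : V, Ck_on k' U (fun x => 'D_v f x))
  end.

Definition smooth_on (U : set V) (f : V -> W) := forall k, Ck_on k U f.

End smooth_maps.

(* [chart_map] and [chart_inv] are total functions, meaningful only on
   [chart_dom] and on [chart_map @` chart_dom] respectively. *)
Record chart (R : realType) (n : nat) (M : topologicalType) := Chart {
  chart_dom : set M ;
  chart_map :> M -> 'rV[R]_n ;
  chart_inv : 'rV[R]_n -> M ;
  chart_dom_open : open chart_dom ;
  chart_codom_open : open (chart_map @` chart_dom) ;
  chart_mapK : {in chart_dom, cancel chart_map chart_inv} ;
  chart_map_continuous : {in chart_dom, continuous chart_map} ;
  chart_inv_continuous : {in chart_map @` chart_dom, continuous chart_inv}
}.

Record smooth_atlas (R : realType) (n : nat) (M : topologicalType) :=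
  SmoothAtlas {
  atlas : set (chart R n M) ;
  chart_at : M -> chart R n M ;
  chart_at_atlas : forall x, atlas (chart_at x) ;
  chart_at_dom : forall x, chart_dom (chart_at x) x ;
  atlas_compatible : forall e e', atlas e -> atlas e' ->
    smooth_on (e @` (chart_dom e `&` chart_dom e')) (e' \o chart_inv e)
}.

Section manifold_differential.
Context {R : realType} {n : nat} {M : topologicalType}.
Variable S : smooth_atlas R n M.

Definition mdifferentiable (f : M -> R) (x : M) : Prop :=
  differentiable (f \o chart_inv (chart_at S x)) (chart_at S x x).

(* The differential of [f] at [x], an element of the cotangent space at [x]
   written in the coordinates of the chart [chart_at S x]. *)
Definition mdiff (f : M -> R) (x : M) : 'rV[R]_n -> R :=
  'd (f \o chart_inv (chart_at S x)) (chart_at S x x).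

Definition emdifferentiable (f : M -> \bar R) (x : M) : Prop :=
  (\forall z \near x, f z \is a fin_num) /\ mdifferentiable (fine \o f) x.

End manifold_differential.

Definition mx_form (R : realType) (n : nat) (B : 'M[R]_n) (v w : 'rV[R]_n) : R :=
  (v *m B *m w^T) 0 0.

(* [metric_mx e x] is the matrix (g_ij(x)) in the coordinates of the chart
   [e]; it is meaningful only for [e] in the atlas and [x] in its domain. *)
Record riemannian_metric (R : realType) (n : nat) (M : topologicalType)
    (S : smooth_atlas R n M) := RiemannianMetric {
  metric_mx : chart R n M -> M -> 'M[R]_n ;
  metric_mx_sym : forall e x, atlas S e -> chart_dom e x ->
    (metric_mx e x)^T = metric_mx e x ;
  metric_mx_posdef : forall e x v, atlas S e -> chart_dom e x -> v != 0 ->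
    0 < mx_form (metric_mx e x) v v ;
  metric_mx_smooth : forall e i j, atlas S e ->
    smooth_on (e @` chart_dom e) (fun z => metric_mx e (chart_inv e z) i j) ;
  metric_mx_compatible : forall e e' x v w, atlas S e -> atlas S e' ->
    chart_dom e x -> chart_dom e' x ->
    mx_form (metric_mx e' x) ('d (e' \o chart_inv e) (e x) v)
                             ('d (e' \o chart_inv e) (e x) w)
    = mx_form (metric_mx e x) v w
}.

Section riemannian_distance.
Context {R : realType} {n : nat} {M : topologicalType}.
Context {S : smooth_atlas R n M}.
Variable g : riemannian_metric S.

Definition C1_curve_on (U : set R) (z : R -> M) :=
  forall t, U t -> {for t, continuous z} /\
    forall e, atlas S e -> chart_dom e (z t) ->
      derivable (e \o z) t 1 /\ {for t, continuous (derive1 (e \o z))}.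

(* On each closed piece of the partition, the curve is the restriction of a C^1
   curve defined on an open neighbourhood of that piece. *)
Definition piecewise_C1_curve (z : R -> M) :=
  exists2 s : seq R, itv_partition 0 1 s &
    forall i, (i < size s)%N ->
      exists U : set R, exists zi : R -> M,
        [/\ open U, `[nth 0 (0 :: s) i, nth 0 s i]%classic `<=` U,
            C1_curve_on U zi &
            forall t, nth 0 (0 :: s) i <= t <= nth 0 s i -> z t = zi t].

Definition curve_speed (z : R -> M) (t : R) : R :=
  let e := chart_at S (z t) in
  let v := derive1 (e \o z) t in
  Num.sqrt (mx_form (metric_mx g e (z t)) v v).

Definition curve_length (z : R -> M) : \bar R :=
  (\int[lebesgue_measure]_(t in `[0%R, 1%R]) (curve_speed z t)%:E)%E.

Definition riemannian_distance (x y : M) : \bar R :=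
  ereal_inf [set l | exists z : R -> M,
    [/\ piecewise_C1_curve z, z 0 = x, z 1 = y & l = curve_length z]].

End riemannian_distance.

(* A Hausdorff separable space carrying a Riemannian metric is automatically
   second countable. *)
Definition complete_separable_riemannian (R : realType) (n : nat)
    (M : topologicalType) (S : smooth_atlas R n M) (g : riemannian_metric S) :=
  [/\ hausdorff_space M, separable M &
      complete_distance (riemannian_distance g)].

Definition non_atomic (d : measure_display) (T : measurableType d)
    (R : realType) (mu : {measure set T -> \bar R}) :=
  forall A, measurable A -> (0 < mu A)%E ->
    exists B, [/\ measurable B, B `<=` A & (0 < mu B < mu A)%E].

Section transport.
Context {R : realType} {X Y : ptopologicalType}.

Definition couplings (mu : probability (borel X) R)
    (nu : probability (borel Y) R) : set (probability (borel (X * Y)%type) R) :=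
  [set p | (forall A : set (borel X), measurable A ->
              p [set z | A z.1] = mu A) /\
           (forall B : set (borel Y), measurable B ->
              p [set z | B z.2] = nu B)].

Definition transport_cost (c : X * Y -> R)
    (p : probability (borel (X * Y)%type) R) : \bar R :=
  (\int[p]_z (c z)%:E)%E.

Definition optimal_plan (c : X * Y -> R) (mu : probability (borel X) R)
    (nu : probability (borel Y) R) (p : probability (borel (X * Y)%type) R) :=
  couplings mu nu p /\
  transport_cost c p = ereal_inf (transport_cost c @` couplings mu nu).

Definition c_concave (c : X * Y -> R) (phi : X -> \bar R) :=
  [/\ forall x, phi x != +oo%E,
      exists x, phi x != -oo%E &
      exists psi : Y -> \bar R, forall x,
        phi x = ereal_inf (range (fun y => (c (x, y))%:E - psi y)%E)].

Definition m_twist (n : nat) (S : smooth_atlas R n X) (c : X * Y -> R)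
    (m : nat) :=
  (forall y x, mdifferentiable S (fun x' => c (x', y)) x) /\
  (forall x0 y0,
    ([set y | mdiff S (fun x => c (x, y)) x0 = mdiff S (fun x => c (x, y0)) x0]
       #<= `I_m)%card).

End transport.

(* Main.v *)
Require Import Defs.
From HB Require Import structures.
From mathcomp Require Import all_boot all_order all_algebra.
From mathcomp Require Import all_classical all_reals all_analysis.
From mathcomp Require Import measurable_realfun lra ring.

Set Implicit Arguments.
Unset Strict Implicit.
Unset Printing Implicit Defensive.

Import Order.TTheory GRing.Theory Num.Theory.
Import numFieldNormedType.Exports.

Local Open Scope classical_set_scope.
Local Open Scope ring_scope.

(** A part of an optimal plan is no more expensive than any measure with the
    same marginals. Comparing the plan conditioned on finitely many small
    cells with products of its marginals on permuted cells shows that the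
    plan is concentrated on a c-cyclically monotone set. Since [Y] is second
    countable, cells cut out of [X] by rational bounds on [c (., y)]
    suffice, and no countable base of [X] is needed. Rockafellar's
    construction then gives a real-valued c-concave potential [phi] whose
    c-superdifferential is closed and has full measure. Where [phi] is
    differentiable, every [y] in the c-superdifferential at [x] satisfies
    d_x c (x, y) = d phi (x), so the m-twist condition leaves at most [m]
    such [y]. As the second marginal is tight, the c-superdifferential may
    be cut down to a sigma-compact part of [Y], along which projections of
    closed sets are Borel; this yields Borel maps whose graphs cover it. The
    weights are the Radon-Nikodym densities of the first marginals of
    [gamma] restricted to the disjointified graphs. *)

(** * Polish spaces *)

(* The sets [V k] need not be open. *)
Definition closed_network (T : topologicalType) (V : nat -> set T) :=
  (forall k, closed (V k)) /\
  (forall (U : set T) y, open U -> U y -> exists2 k, V k y & V k `<=` U).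

Lemma closed_network_separates (T : topologicalType) (V : nat -> set T)
    (y y' : T) :
  closed_network V -> hausdorff_space T -> y <> y' ->
  exists k l, [/\ V k y, V l y' & V k `&` V l = set0].
Proof.
move=> [_ nV]; rewrite open_hausdorff => hT /eqP/hT[[A A'] /=].
move=> [/set_mem Ay /set_mem Ay'] [oA oA' /eqP AA'].
have [k Vk kA] := nV _ _ oA Ay; have [l Vl lA'] := nV _ _ oA' Ay'.
by exists k, l; split => //; rewrite -subset0 -AA'; exact: setISS.
Qed.

Section metrizable.
Context {R : realType} {Y : ptopologicalType}.
Variable d : Y -> Y -> R.
Hypotheses (d_metric : is_metric d) (d_top : metrizes_topology d).

Let d_sym x y : d x y = d y x. Proof. by case: d_metric. Qed.

Let d_triangle y x z : d x z <= d x y + d y z. Proof. by case: d_metric. Qed.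

Lemma metric_ball_nbhs (y : Y) (e : R) : 0 < e -> nbhs y [set z | d y z < e].
Proof. by move=> e0; apply/d_top; exists e. Qed.

Lemma metrizable_hausdorff : hausdorff_space Y.
Proof.
move=> x y xy; case: d_metric => d_ge0 d_eq0 _ _.
apply/d_eq0/eqP/negPn/negP => dxy.
have e0 : 0 < d x y / 2 by rewrite divr_gt0// lt_def dxy d_ge0.
have [z [/= xz yz]] := xy _ _ (metric_ball_nbhs x e0) (metric_ball_nbhs y e0).
by have := d_triangle z x y; rewrite (d_sym z y); lra.
Qed.

Definition metric_cball (x : Y) (e : R) : set Y := [set y | d x y <= e].

Lemma metric_cball_closed x e : closed (metric_cball x e).
Proof.
rewrite -openC openE => y /negP; rewrite -ltNge -subr_gt0.
move=> /(metric_ball_nbhs y); apply: filterS => z /= yz /=.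
by apply/negP; rewrite -ltNge; have := d_triangle z x y; rewrite (d_sym z y);
  lra.
Qed.

Lemma separable_dense_sequence : separable Y ->
  exists u : nat -> Y, forall (y : Y) (e : R), 0 < e -> exists k, d (u k) y < e.
Proof.
move=> [D /pcard_geP/unsquash u dD]; exists u => y e /(metric_ball_nbhs y) ye.
have [z [/interior_subset /= yz]] := dD _ (ex_intro _ y ye) (open_interior _).
by move=> /(@surj _ _ _ _ u)[k _ uk]; exists k; rewrite uk d_sym.
Qed.

Lemma separable_closed_network : separable Y ->
  exists V : nat -> set Y, closed_network V.
Proof.
move=> /separable_dense_sequence[u u_dense].
pose V k := let ij := odflt (0, 0)%N (unpickle k) in
  metric_cball (u ij.1) ij.2.+1%:R^-1.
exists V; split=> [k|U y oU Uy]; first exact: metric_cball_closed.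
have /d_top[e e0 eU] : nbhs y U by exact: open_nbhs_nbhs.
have [j je] := ltr_add_invr (divr_gt0 e0 (ltr0n R 2)).
have [i ui] := u_dense y j.+1%:R^-1 (ltac:(by rewrite invr_gt0)).
exists (pickle (i, j)); rewrite /V pickleK /metric_cball /=; first exact: ltW.
move=> z /= uz; apply: eU => /=; have := d_triangle (u i) y z.
by move: (j.+1%:R^-1) je ui uz => r; rewrite (d_sym y (u i)); lra.
Qed.

Hypothesis d_complete : complete_distance (fun x y => (d x y)%:E).

(* Centres of balls of radius [n.+1%:R^-1] belonging to the filter form a Cauchy
   sequence. *)
Lemma complete_cauchy_filter_cvg (U : set_system Y) : ProperFilter U ->
  (forall e : R, 0 < e -> exists x, U (metric_cball x e)) ->
  exists l : Y, U --> l.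
Proof.
move=> UU small.
have /choice[x Ux] (n : nat) : exists x, U (metric_cball x n.+1%:R^-1).
  by apply: small; rewrite invr_gt0.
have xx p q : d (x p) (x q) <= p.+1%:R^-1 + q.+1%:R^-1.
  have [z [/= pz qz]] := filter_ex (filterI (Ux p) (Ux q)).
  by apply: le_trans (d_triangle z _ _) _; rewrite lerD// d_sym.
have invS_le (N p : nat) : (N <= p)%N -> p.+1%:R^-1 <= N.+1%:R^-1 :> R.
  by move=> Np; rewrite lef_pV2 ?posrE// ler_nat.
have [|l xl] := d_complete (u := x).
  move=> e e0; have [N +] := ltr_add_invr (divr_gt0 e0 (ltr0n R 2)).
  rewrite add0r => Ne; exists N => p q /invS_le Np /invS_le Nq.
  rewrite lte_fin (splitr e); apply: le_lt_trans (xx p q) _.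
  by apply: ltrD; [exact: le_lt_trans Ne|exact: le_lt_trans Ne].
exists l => A /d_top[e e0 eA].
have e20 : 0 < e / 2 by rewrite divr_gt0.
have xnl : \forall n \near \oo, d l (x n) < e / 2.
  exact: xl (metric_ball_nbhs l e20).
have [n [/= ln ne]] :=
  filter_ex (filterI xnl (near_infty_natSinv_lt (PosNum e20))).
apply: filterS (Ux n) => y /= ny; apply: eA => /=.
rewrite (splitr e); apply: le_lt_trans (d_triangle (x n) l y) _.
by apply: ltrD => //; exact: le_lt_trans ne.
Qed.

Definition metric_totally_bounded (F : set Y) := forall e : R, 0 < e ->
  exists s : seq Y, forall y, F y -> exists2 x, x \in s & d x y <= e.

Lemma totally_bounded_closed_compact (F : set Y) :
  metric_totally_bounded F -> closed F -> compact F.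
Proof.
move=> Ftb cF; rewrite compact_ultra => U UU UF.
have [|l Ul] := complete_cauchy_filter_cvg (U := U).
  move=> e /Ftb[s sF].
  have : U [set y | exists2 x, x \in s & d x y <= e] by apply: filterS UF.
  elim: s {sF} => [|x s IH] Us; first by have [? [?]] := filter_ex Us.
  have [?|Unx] := in_ultra_setVsetC (metric_cball x e) UU; first by exists x.
  apply: IH; apply: filterS (filterI Us Unx) => y [[z]].
  by rewrite inE => /predU1P[->//|zs zy _]; exists z.
by exists l; split => //; apply: (closed_cvg F cF _ _ Ul).
Qed.

End metrizable.

Section polish.
Context {R : realType} {Y : ptopologicalType}.

Lemma polish_hausdorff : polish_space R Y -> hausdorff_space Y.
Proof. by move=> [_ [d [dm dtop _]]]; exact: metrizable_hausdorff dm dtop. Qed.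

Lemma polish_closed_network : polish_space R Y ->
  exists V : nat -> set Y, closed_network V.
Proof.
by move=> [sY [d [dm dtop _]]]; exact: separable_closed_network dm dtop sY.
Qed.

End polish.

(** * Borel sets *)

HB.instance Definition _ (X Y : ptopologicalType) := Pointed.on (X * Y)%type.

Lemma open_measurable_borel (T : ptopologicalType) (U : set T) :
  open U -> measurable (U : set (borel T)).
Proof. by move=> oU; exact: sub_sigma_algebra. Qed.

Lemma closed_measurable_borel (T : ptopologicalType) (C : set T) :
  closed C -> measurable (C : set (borel T)).
Proof.
by rewrite -openC => /open_measurable_borel /measurableC; rewrite setCK.
Qed.

Lemma measurable_fun_borel (d : measure_display) (S : measurableType d)
    (T : ptopologicalType) (f : S -> T) :
  (forall U, open U -> measurable (f @^-1` U)) ->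
  measurable_fun [set: S] (f : S -> borel T).
Proof.
move=> fU; apply: (@measurability _ _ S (borel T) setT f (@open T)) => //.
by move=> _ [U oU <-]; rewrite setTI; exact: fU.
Qed.

Lemma continuous_measurable_borel (T U : ptopologicalType) (f : T -> U) :
  continuous f -> measurable_fun [set: borel T] (f : borel T -> borel U).
Proof.
move=> cf; apply: measurable_fun_borel => V oV; apply: open_measurable_borel.
by apply: open_comp => // x _; exact: cf.
Qed.

Lemma continuous_measurable_borelR (R : realType) (T : ptopologicalType)
    (f : T -> R) :
  continuous f -> measurable_fun [set: borel T] (f : borel T -> R).
Proof.
move=> cf; apply: (measurability _ (RGenOpens.measurableE R)).
move=> _ [V [a [b ->]] <-]; rewrite setTI; apply: open_measurable_borel.
apply: open_comp; [by move=> x _; exact: cf|exact: interval_open].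
Qed.

Section closed_network_measurability.
Context {Y : ptopologicalType}.
Variable V : nat -> set Y.
Hypothesis nV : closed_network V.

Lemma closed_network_bigcup (U : set Y) :
  open U -> U = \bigcup_(k in [set k | V k `<=` U]) V k.
Proof.
move=> oU; apply/seteqP; split=> [y Uy|y [k VU Vy]]; last exact: VU.
by have [k Vy VU] := nV.2 _ _ oU Uy; exists k.
Qed.

Lemma closed_network_measurable k : measurable (V k : set (borel Y)).
Proof. by apply: closed_measurable_borel; exact: nV.1. Qed.

Lemma measurable_fun_closed_network (d : measure_display)
    (S : measurableType d) (f : S -> Y) :
  (forall k, measurable (f @^-1` V k)) ->
  measurable_fun [set: S] (f : S -> borel Y).
Proof.
move=> fV; apply: measurable_fun_borel => U /closed_network_bigcup ->.
by rewrite preimage_bigcup; exact: bigcup_measurable.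
Qed.

Lemma open_prod_bigcup (X : topologicalType) (A : set (X * Y)) : open A ->
  exists2 U : nat -> set X, forall k, open (U k) & A = \bigcup_k (U k `*` V k).
Proof.
move=> oA; exists (fun k => interior [set x | forall y, V k y -> A (x, y)]).
  by move=> k; exact: open_interior.
apply/seteqP; split=> [[x y] Axy|[x y] [k _ [/= /interior_subset Ux Vy]]];
  last exact: Ux.
have [[P Q] /= [Px Qy] PQA] : nbhs (x, y) A by exact: open_nbhs_nbhs.
have [k Vy VQ] := nV.2 _ _ (open_interior Q) Qy.
exists k => //; split => //=; rewrite /interior.
by apply: filterS Px => x' Px' y' /VQ/interior_subset Qy'; exact: PQA.
Qed.

Lemma measurable_fun_pair_borel (d : measure_display) (S : measurableType d)
    (X : ptopologicalType) (f : S -> X) (g : S -> Y) :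
  measurable_fun [set: S] (f : S -> borel X) ->
  measurable_fun [set: S] (g : S -> borel Y) ->
  measurable_fun [set: S] ((fun s => (f s, g s)) : S -> borel (X * Y)%type).
Proof.
move=> mf mg; apply: (@measurable_fun_borel _ S (X * Y)%type) => A.
move=> /open_prod_bigcup[U oU ->].
rewrite preimage_bigcup; apply: bigcup_measurable => k _.
rewrite (_ : _ @^-1` _ = f @^-1` U k `&` g @^-1` V k)//.
apply: measurableI; rewrite -[_ @^-1` _]setTI; [apply: mf|apply: mg] => //.
  exact: open_measurable_borel.
exact: closed_network_measurable.
Qed.

End closed_network_measurability.

Section product.
Context {X Y : ptopologicalType}.

Definition borel_fst : borel (X * Y)%type -> borel X := fst.

Lemma measurable_borel_fst : measurable_fun setT borel_fst.
Proof. by apply: continuous_measurable_borel => z; exact: cvg_fst. Qed.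

HB.instance Definition _ :=
  isMeasurableFun.Build _ _ _ _ borel_fst measurable_borel_fst.

Definition borel_snd : borel (X * Y)%type -> borel Y := snd.

Lemma measurable_borel_snd : measurable_fun setT borel_snd.
Proof. by apply: continuous_measurable_borel => z; exact: cvg_snd. Qed.

HB.instance Definition _ :=
  isMeasurableFun.Build _ _ _ _ borel_snd measurable_borel_snd.

Lemma measurable_fst_preimage (A : set (borel X)) :
  measurable A -> measurable (borel_fst @^-1` A).
Proof.
by move=> mA; rewrite -[_ @^-1` _]setTI; exact: measurable_borel_fst.
Qed.

Lemma measurable_snd_preimage (B : set (borel Y)) :
  measurable B -> measurable (borel_snd @^-1` B).
Proof.
by move=> mB; rewrite -[_ @^-1` _]setTI; exact: measurable_borel_snd.
Qed.

Lemma measurable_setX_borel (A : set (borel X)) (B : set (borel Y)) :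
  measurable A -> measurable B ->
  measurable (A `*` B : set (borel (X * Y)%type)).
Proof.
by move=> mA mB; apply: measurableI;
  [exact: measurable_fst_preimage|exact: measurable_snd_preimage].
Qed.

Lemma measurable_graph (V : nat -> set Y) (G : X -> Y) :
  closed_network V -> hausdorff_space Y ->
  measurable_fun [set: borel X] (G : borel X -> borel Y) ->
  measurable ([set z | G z.1 = z.2] : set (borel (X * Y)%type)).
Proof.
move=> nV hY mG.
rewrite (_ : [set _ | _] = ~` \bigcup_k
    \bigcup_(l in [set l | V k `&` V l = set0]) ((G @^-1` V k) `*` V l)).
  apply: measurableC; apply: bigcup_measurable => k _.
  apply: bigcup_measurable => l _; apply: measurable_setX_borel.
    by rewrite -[_ @^-1` _]setTI; apply: mG => //;
      exact: closed_network_measurable.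
  exact: closed_network_measurable.
apply/seteqP; split=> [[x y] /= <- [k _ [l /= kl [/= Gk Gl]]]|[x y] /= nxy].
  by have : (V k `&` V l) (G x) by []; rewrite kl.
apply: contrapT => /(closed_network_separates nV hY)[k [l [Vk Vl kl]]].
by apply: nxy; exists k => //; exists l.
Qed.

End product.

(** * Tightness *)

Lemma finite_measure_exhaustion (R : realType) (d : measure_display)
    (T : measurableType d) (p : {finite_measure set T -> \bar R})
    (B : nat -> set T) (e : R) :
  (forall n, measurable (B n)) -> nondecreasing_seq B ->
  \bigcup_n B n = setT -> 0 < e -> exists n, (p (~` B n) < e%:E)%E.
Proof.
move=> mB ndB BT e0.
have mBC n : measurable (~` B n) by exact: measurableC.
have : p \o (fun n => ~` B n) @ \oo --> p (\bigcap_n ~` B n).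
  apply: nonincreasing_cvg_mu => //.
  - by rewrite -ge0_fin_numE ?fin_num_measure// measure_ge0.
  - exact: bigcap_measurable.
  - by move=> i j /ndB/subsetPset BB; exact/subsetPset/subsetC.
rewrite -setC_bigcup BT setCT measure0.
move=> /(_ [set x | (x < e%:E)%E]) small.
have [|n _ /(_ n (leqnn n))] := small; last by exists n.
by apply: open_nbhs_nbhs; split;
  [exact: open_ereal_lt_ereal|rewrite /= lte_fin].
Qed.

Section tightness.
Context {R : realType} {Y : ptopologicalType}.
Variable p : probability (borel Y) R.
Hypothesis hY : polish_space R Y.

(* Ulam's argument: intersect over [l] finite unions of balls of radius
   [l.+1%:R^-1] covering all but [e / 2 ^ l.+1] of the mass. *)
Lemma polish_probability_tight (e : R) : 0 < e ->
  exists2 K : set Y, compact K & (p (~` K) <= e%:E)%E.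
Proof.
move=> e0; have [sY [d [dm dtop dcompl]]] := hY.
have [u u_dense] := separable_dense_sequence dm dtop sY.
pose B (l n : nat) : set (borel Y) :=
  \bigcup_(j in `I_n) metric_cball d (u j) l.+1%:R^-1.
have cB l n : closed (B l n : set Y).
  apply: closed_bigcup => [|j _]; first exact: finite_II.
  exact: metric_cball_closed.
have mB l n : measurable (B l n) by exact: closed_measurable_borel.
have /choice[n pB] l : exists n, (p (~` B l n) < (e / (2 ^ l.+1)%:R)%:E)%E.
  apply: finite_measure_exhaustion => //.
  - by move=> i j ij; apply/subsetPset/bigcup_subset => k /leq_trans; exact.
  - rewrite -subTset => y _.
    have [k uk] := u_dense y l.+1%:R^-1 (ltac:(by rewrite invr_gt0)).
    by exists k.+1 => //; exists k => /=; [|exact: ltW].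
  - by rewrite divr_gt0// ltr0n expn_gt0.
have cK : closed (\bigcap_l B l (n l) : set Y) by exact: closed_bigI.
exists (\bigcap_l B l (n l)).
  apply: (totally_bounded_closed_compact dm dtop dcompl) => // r r0.
  have [l] := ltr_add_invr r0; rewrite add0r => lr.
  exists (map u (iota 0 (n l))) => y /(_ l I)[j jn jy].
  exists (u j); last exact: le_trans jy (ltW lr).
  by apply: map_f; rewrite mem_iota.
apply: le_trans (epsilon_trick0 xpredT (ltW e0)).
apply: (@le_trans _ _ (\sum_(l <oo) p (~` B l (n l)))%E).
  apply: measure_sigma_subadditive; last by rewrite setC_bigcap.
    by move=> l; exact: measurableC.
  by apply: measurableC; exact: closed_measurable_borel.
by apply: lee_nneseries => // l _; exact: ltW.
Qed.

Lemma polish_probability_sigma_compact :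
  exists2 F : nat -> set Y, forall n, compact (F n) &
    {ae p, forall y, (\bigcup_n F n) y}.
Proof.
have /choice[F F_tight] (n : nat) :
    exists F : set Y, compact F /\ (p (~` F) <= (n.+1%:R^-1)%:E)%E.
  have [|F cF pF] := @polish_probability_tight n.+1%:R^-1; last by exists F.
  by rewrite invr_gt0.
exists F; first by move=> n; have [] := F_tight n.
have mF n : measurable (F n : set (borel Y)).
  apply: closed_measurable_borel; apply: compact_closed (F_tight n).1.
  exact: polish_hausdorff hY.
have mU : measurable (\bigcup_n F n : set (borel Y)).
  by apply: bigcup_measurable => n _; exact: mF.
exists (~` \bigcup_n F n); split => //; first exact: measurableC.
apply/eqP; rewrite -measure_le0; apply/lee_addgt0Pr => e e0; rewrite add0e.
have [n] := ltr_add_invr e0; rewrite add0r => ne.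
apply: (@le_trans _ _ (n.+1%:R^-1)%:E); last by rewrite lee_fin ltW.
apply: le_trans (F_tight n).2; apply: le_measure; rewrite ?inE.
- exact: measurableC.
- exact: measurableC.
- by apply: subsetC; exact: bigcup_sup.
Qed.

End tightness.

(** * Measurable selections of finite multifunctions *)

Section multifunctions.
Context {d : measure_display} {X : measurableType d} {Y : ptopologicalType}.

Definition hitting_set (Phi : X -> set Y) (E : set Y) : set X :=
  [set x | Phi x `&` E !=set0].

Definition measurable_multifunction (Phi : X -> set Y) :=
  forall C, closed C -> measurable (hitting_set Phi C).

Variables (V : nat -> set Y) (nV : closed_network V).

Lemma hitting_set_open_measurable (Phi : X -> set Y) (U : set Y) :
  measurable_multifunction Phi -> open U -> measurable (hitting_set Phi U).
Proof.
move=> mPhi oU.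
rewrite (_ : hitting_set Phi U =
    \bigcup_(k in [set k | V k `<=` U]) hitting_set Phi (V k)).
  by apply: bigcup_measurable => k _; apply: mPhi; exact: nV.1.
apply/seteqP; split=> x; last first.
  by move=> [k kU [y [Phiy /kU Uy]]]; exists y.
by move=> [y [Phiy /(nV.2 _ _ oU)[k Vy kU]]]; exists k => //; exists y.
Qed.

Lemma measurable_fun_xget (Phi : X -> set Y) :
  measurable_multifunction Phi -> (forall x, is_subset1 (Phi x)) ->
  measurable_fun setT ((fun x => xget point (Phi x)) : X -> borel Y).
Proof.
move=> mPhi Phi1; apply: (measurable_fun_closed_network nV) => k.
rewrite (_ : _ @^-1` _ = hitting_set Phi (V k) `|`
    (if `[< V k point >] then ~` hitting_set Phi setT else set0)).
  apply: measurableU; first by apply: mPhi; exact: nV.1.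
  by case: ifP => // _; apply: measurableC; apply: mPhi; exact: closedT.
have hitP x y : Phi x y -> xget point (Phi x) = y.
  by move=> Phiy; exact: xget_subset1.
apply/seteqP; split=> x /=.
  have [[y Phiy]|none] := pselect (Phi x !=set0).
    by rewrite (hitP _ _ Phiy) => Vy; left; exists y.
  rewrite xgetPN => [Vp|y Phiy]; last by apply: none; exists y.
  by right; case: asboolP => // _ [y [Phiy _]]; apply: none; exists y.
move=> [[y [Phiy Vy]]|]; first by rewrite (hitP _ _ Phiy).
case: asboolP => // Vp none; rewrite xgetPN// => y Phiy.
by apply: none; exists y.
Qed.

Hypothesis hY : hausdorff_space Y.

Lemma measurable_subset1_section (Phi : X -> set Y) (C : set Y) :
  measurable_multifunction Phi -> closed C ->
  measurable [set x | is_subset1 (Phi x `&` C)].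
Proof.
move=> mPhi cC.
rewrite (_ : [set _ | _] = ~` \bigcup_k
    \bigcup_(l in [set l | V k `&` V l = set0])
      (hitting_set Phi (C `&` V k) `&` hitting_set Phi (C `&` V l))).
  apply: measurableC; apply: bigcup_measurable => k _.
  apply: bigcup_measurable => l _.
  by apply: measurableI; apply: mPhi; apply: closedI => //; exact: nV.1.
apply/seteqP; split=> x.
  move=> sub1 [k _ [l /= kl [[y [Py [Cy Vy]]] [z [Pz [Cz Vz]]]]]].
  have : (V k `&` V l) y by split=> //; rewrite (sub1 y z).
  by rewrite kl.
move=> nosep y z [Py Cy] [Pz Cz]; apply: contrapT.
move=> /(closed_network_separates nV hY)[k [l [Vk Vl kl]]].
by apply: nosep; exists k => //; exists l => //; split; [exists y|exists z].
Qed.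

Variables (Phi : X -> set Y) (m : nat).
Hypothesis mPhi : measurable_multifunction Phi.

Definition isolated_by (t : seq nat) : set X :=
  [set x | Phi x `<=` \bigcup_(i in `I_m) V (nth 0%N t i)] `&`
  \bigcap_(i in `I_m) [set x | is_subset1 (Phi x `&` V (nth 0%N t i))].

Lemma measurable_isolated_by t : measurable (isolated_by t).
Proof.
apply: measurableI; last first.
  apply: bigcap_measurableType => i _.
  by apply: measurable_subset1_section => //; exact: nV.1.
rewrite (_ : [set _ | _] =
    ~` hitting_set Phi (~` \bigcup_(i in `I_m) V (nth 0%N t i))).
  apply/measurableC/hitting_set_open_measurable => //; rewrite openC.
  by apply: closed_bigcup => [|i _]; [exact: finite_II|exact: nV.1].
apply/seteqP; split=> x /= cover; first by move=> [y [/cover]].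
by move=> y Py; apply: contrapT => ny; apply: cover; exists y.
Qed.

Lemma exists_isolated_by x : (Phi x #<= `I_m)%card -> exists t, isolated_by t x.
Proof.
move=> /pcard_geP/unsquash f.
have /choice[k fk] i : exists k, V k (f i) /\
    V k `<=` ~` \bigcup_(j in `I_m `&` [set j | f j <> f i]) [set f j].
  have [||k Vk kf] := nV.2
    (~` \bigcup_(j in `I_m `&` [set j | f j <> f i]) [set f j]) (f i).
  - rewrite openC; apply: closed_bigcup => [|j _].
      by apply: finite_setIl; exact: finite_II.
    by apply: accessible_closed_set1; exact: hausdorff_accessible.
  - by move=> [j [_ /= ji]]; exact: nesym.
  by exists k.
have fP y : Phi x y -> exists2 i, (i < m)%N & f i = y.
  by move=> /(@surj _ _ _ _ f)[i]; exists i.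
exists (mkseq k m); split=> [y /fP[i im <-]|i /= im].
  by exists i => //; rewrite nth_mkseq//; exact: (fk i).1.
have eqf j : (j < m)%N -> V (k i) (f j) -> f j = f i.
  move=> jm /(fk i).2 nf; apply: contrapT => ji.
  by apply: nf; exists j.
rewrite nth_mkseq// => _ _ [/fP[j jm <-] Vj] [/fP[l lm <-] Vl].
by rewrite (eqf j)// (eqf l).
Qed.

Lemma finite_multifunction_selection :
  exists G : nat -> X -> Y,
    (forall i, measurable_fun setT (G i : X -> borel Y)) /\
    (forall x y, (Phi x #<= `I_m)%card -> Phi x y ->
      exists2 i, (i < m)%N & G i x = y).
Proof.
pose T j : seq nat := odflt [::] (unpickle j).
pose D := seqDU (isolated_by \o T).
have mD j : measurable (D j).
  by apply: seqDU_measurable => k; exact: measurable_isolated_by.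
have D_isolated j x : D j x -> isolated_by (T j) x by exact: subset_seqDU.
pose Psi i x := [set y | (i < m)%N /\
  exists2 j, D j x & (Phi x `&` V (nth 0%N (T j) i)) y].
have Psi1 i x : is_subset1 (Psi i x).
  move=> y z [im [j Dj yP]] [_ [l Dl zP]].
  have jl : j = l by apply: (trivIset_seqDU (isolated_by \o T)) => //; exists x.
  by rewrite -{}jl in zP; have [_ sub1] := D_isolated _ _ Dj; exact: (sub1 i).
have mPsi i : measurable_multifunction (Psi i).
  move=> C cC; have [im|mi] := ltnP i m; last first.
    rewrite (_ : hitting_set _ _ = set0)// -subset0 => x [y [[]]].
    by rewrite ltnNge mi.
  rewrite (_ : hitting_set _ _ =
      \bigcup_j (D j `&` hitting_set Phi (V (nth 0%N (T j) i) `&` C))).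
    apply: bigcup_measurable => j _; apply: measurableI => //.
    by apply: mPhi; apply: closedI => //; exact: nV.1.
  apply/seteqP; split=> x.
    by move=> [y [[_ [j Dj [Py Vy]]] Cy]]; exists j => //; split=> //; exists y.
  move=> [j _ [Dj [y [Py [Vy Cy]]]]].
  by exists y; split=> //; split=> //; exists j.
exists (fun i x => xget point (Psi i x)); split=> [i|x y].
  exact: measurable_fun_xget.
move=> /exists_isolated_by[t xt] Py.
have [j _ Dj] : (\bigcup_j D j) x.
  by rewrite -seqDU_bigcup_eq; exists (pickle t) => //=; rewrite /T pickleK.
have [cover _] := D_isolated _ _ Dj; have [i im Vy] := cover y Py.
by exists i => //; apply: xget_subset1 => //; split=> //; exists j.
Qed.

End multifunctions.

Lemma compact_closed_projection (X Y : topologicalType) (F : set Y)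
    (K : set (X * Y)) :
  compact F -> closed K -> closed [set x | exists2 y, F y & K (x, y)].
Proof.
move=> /compact_near_coveringP cF; rewrite -openC => oK.
rewrite -openC openE => x nx.
have : \forall x' \near x, F `<=` (fun y => ~ K (x', y)).
  apply: cF => y Fy; have : nbhs (x, y) (~` K).
    by apply: open_nbhs_nbhs; split => // Kxy; apply: nx; exists y.
  move=> [[P Q] /= [Px Qy] PQ].
  by exists (Q, P) => //= -[y' x'] [/= Qy' Px']; exact: (PQ (x', y')).
by apply: filterS => x' Fx' [y Fy]; exact: Fx'.
Qed.

Lemma sigma_compact_section_measurable (X Y : ptopologicalType)
    (F : nat -> set Y) (K : set (X * Y)) :
  (forall n, compact (F n)) -> closed K ->
  measurable_multifunction
    ((fun x => \bigcup_n F n `&` [set y | K (x, y)]) : borel X -> set Y).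
Proof.
move=> cF cK C cC; rewrite (_ : hitting_set _ _ =
    \bigcup_n [set x : borel X |
      exists2 y, F n y & (K `&` [set z | C z.2]) (x, y)]).
  apply: bigcup_measurable => n _; apply: closed_measurable_borel.
  apply: compact_closed_projection => //; apply: closedI => //.
  by apply: (@closed_comp _ _ (@snd X Y)) => // z _; exact: cvg_snd.
apply/seteqP; split=> x.
  by move=> [y [[[n _ Fy] Kxy] Cy]]; exists n => //; exists y.
by move=> [n _ [y Fy [Kxy Cy]]]; exists y; split=> //; split=> //; exists n.
Qed.

(** * Exchanging parts of a minimal plan *)

Section measures.
Context {d : measure_display} {T : measurableType d} {R : realType}.

Lemma mnormalize_mass1 (m : {measure set T -> \bar R}) (P : probability T R) :
  m setT = 1%E -> mnormalize m P = m.
Proof.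
by move=> m1; apply/funext => A; rewrite /mnormalize m1 onee_eq0/= invr1 mule1.
Qed.

(* [msum] sums families indexed by [nat]. *)
Definition ord_msum n (m : 'I_n.+1 -> {measure set T -> \bar R}) :=
  msum (m \o inord) n.+1.

HB.instance Definition _ n (m : 'I_n.+1 -> {measure set T -> \bar R}) :=
  Measure.on (ord_msum m).

Lemma ord_msumE n (m : 'I_n.+1 -> {measure set T -> \bar R}) (A : set T) :
  ord_msum m A = (\sum_i m i A)%E.
Proof. by apply: eq_bigr => i _; rewrite /= inord_val. Qed.

Lemma ge0_integral_ord_msum n (m : 'I_n.+1 -> {measure set T -> \bar R})
    (f : T -> \bar R) :
  (forall x, 0 <= f x)%E -> measurable_fun setT f ->
  (\int[ord_msum m]_x f x = \sum_i \int[m i]_x f x)%E.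
Proof.
move=> f0 mf; rewrite ge0_integral_measure_sum//.
by apply: eq_bigr => i _; rewrite /= inord_val.
Qed.

Variable P : probability T R.

Lemma probability_ae_nonempty (D : set T) :
  {ae P, forall x, D x} -> D !=set0.
Proof.
move=> aeD; apply: (@filter_ex _ (almost_everywhere P)) => //.
apply: ae_properfilter_algebraOfSetsType.
by rewrite [ltRHS]probability_setT lte01.
Qed.

Lemma probability_integral_ge (D : set T) (f : T -> R) (l : R) :
  measurable D -> P D = 1%E -> (forall x, 0 <= f x) -> measurable_fun setT f ->
  (forall x, D x -> l <= f x) -> (l%:E <= \int[P]_x (f x)%:E)%E.
Proof.
move=> mD D1 f0 mf lf.
have mfE : measurable_fun setT (EFin \o f) by exact/measurable_EFinP.
have [l0|l0] := ltP l 0.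
  by apply: le_trans (integral_ge0 _ _) => [|x _]; rewrite lee_fin// ltW.
apply: le_trans (ge0_subset_integral _ mD _ mfE _ (@subsetT _ D)) => //;
  last by move=> x _; rewrite lee_fin.
rewrite -[leLHS]mule1 -D1 -integral_cst//; apply: ge0_le_integral => //.
exact: measurable_funTS.
Qed.

Lemma probability_integral_le (D : set T) (f : T -> R) (u : R) :
  measurable D -> P D = 1%E -> (forall x, 0 <= f x) -> measurable_fun setT f ->
  (forall x, D x -> f x <= u) -> (\int[P]_x (f x)%:E <= u%:E)%E.
Proof.
move=> mD D1 f0 mf fu.
have u0 : 0 <= u.
  have [x Dx] : D !=set0.
    by apply/set0P/eqP => D0; move/eqP: D1; rewrite D0 measure0 eq_sym onee_eq0.
  exact: le_trans (fu x Dx).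
rewrite -[leRHS]mule1 -(probability_setT P) -integral_cst//.
apply: ae_ge0_le_integral => //; first by move=> x _; rewrite lee_fin.
- exact/measurable_EFinP.
- exists (~` D); split; first exact: measurableC.
    by rewrite [LHS]probability_setC// D1 subee.
  by move=> x /= nfu Dx; apply: nfu => _; rewrite lee_fin; exact: fu.
Qed.

Definition conditional (D : set T) (mD : measurable D) : probability T R :=
  mnormalize (mrestr P mD) P.

Section conditional_probability.
Variables (D : set T) (mD : measurable D).
Hypothesis D0 : P D != 0%E.

Lemma fine_probability_gt0 : 0 < fine (P D).
Proof.
by rewrite fine_gt0// lt0e D0 measure_ge0 -ge0_fin_numE ?fin_num_measure.
Qed.

Lemma conditionalE (A : set T) :
  conditional mD A = (P (A `&` D) * (fine (P D))^-1%:E)%E.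
Proof.
rewrite /conditional /= /mnormalize /= /mrestr setTI (negbTE D0)/=.
by rewrite ifF// -(@fineK _ (P D))// fin_num_measure.
Qed.

Lemma conditional_superset (A : set T) : D `<=` A -> conditional mD A = 1%E.
Proof.
move=> DA; rewrite conditionalE setIidr// -{1}(@fineK _ (P D)).
  by rewrite -EFinM divff// gt_eqF// fine_probability_gt0.
by rewrite fin_num_measure.
Qed.

End conditional_probability.

(* [k] is the inverse of the sum of the [1 / P (D i)], so that the weights
   [k / P (D i)] sum to [1]; the remainder is the mixture, with these weights,
   of the restrictions of [P] to the complements of the [D i]. *)
Lemma conditional_sum_remainder n (D : 'I_n.+1 -> set T)
    (mD : forall i, measurable (D i)) :
  (forall i, P (D i) != 0%E) ->
  exists (k : {nonneg R}) (r : {measure set T -> \bar R}), 0 < k%:num /\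
    forall A, measurable A ->
      P A = (r A + k%:num%:E * \sum_i conditional (mD i) A)%E.
Proof.
move=> D0; pose p i := fine (P (D i)).
have p0 i : 0 < p i by exact: fine_probability_gt0.
have k0 : 0 < (\sum_i (p i)^-1)^-1.
  rewrite invr_gt0 (bigD1 ord0)//= ltr_wpDr ?invr_gt0// sumr_ge0// => i _.
  by rewrite invr_ge0 ltW.
pose k : {nonneg R} := NngNum (ltW k0).
have q0 i : 0 <= k%:num / p i by rewrite divr_ge0// ltW.
have q1 : \sum_i k%:num / p i = 1.
  by rewrite -mulr_sumr mulVf// gt_eqF// -invr_gt0.
pose r := ord_msum (fun i =>
  mscale (NngNum (q0 i)) (mrestr P (measurableC (mD i)))).
exists k, r; split=> // A mA.
rewrite [X in (X + _)%E]ord_msumE ge0_sume_distrr; last first.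
  by move=> i _; exact: measure_ge0.
rewrite -big_split/= -{1}[P A]mul1e -q1 -sumEFin ge0_sume_distrl; last first.
  by move=> i _; rewrite lee_fin.
apply: eq_bigr => i _; rewrite conditionalE//= /mscale/= /mrestr -setDE.
rewrite (measureDI P mA (mD i)) muleDr//; last first.
  by apply: ge0_adde_def; rewrite inE measure_ge0.
by rewrite (muleC (P _) _^-1%:E) muleA -EFinM.
Qed.

End measures.

Section couplings.
Context {R : realType} {X Y : ptopologicalType}.
Local Notation XY := (borel (X * Y)%type).

Lemma independent_coupling (V : nat -> set Y) (mu : probability (borel X) R)
    (nu : probability (borel Y) R) : closed_network V ->
  exists p : probability XY R,
    forall (A : set (borel X)) (B : set (borel Y)),
      measurable A -> measurable B -> p (A `*` B) = (mu A * nu B)%E.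
Proof.
move=> nV; pose pair (z : borel X * borel Y) : XY := (z.1, z.2).
have mpair : measurable_fun setT pair.
  exact: measurable_fun_pair_borel nV _ _ _ _ _ measurable_fst measurable_snd.
pose pair_mfun : {mfun _ >-> _} :=
  HB.pack pair (isMeasurableFun.Build _ _ _ _ pair mpair).
exists (distribution (mnormalize (mu \x nu)%E (\d_point)) pair_mfun).
have prod1E A B : measurable A -> measurable B ->
    ((mu \x nu) (A `*` B) = mu A * nu B)%E by exact: product_measure1E.
move=> A B mA mB; rewrite /distribution /pushforward /= mnormalize_mass1.
  by rewrite -prod1E//; congr (product_measure1 _ _ _); apply/seteqP; split.
by rewrite -setXTT [LHS]prod1E// !probability_setT mule1.
Qed.

Definition same_marginals (p q : set XY -> \bar R) :=
  (forall A, measurable A -> p (borel_fst @^-1` A) = q (borel_fst @^-1` A)) /\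
  (forall B, measurable B -> p (borel_snd @^-1` B) = q (borel_snd @^-1` B)).

Definition cost_minimal (c : X * Y -> R) (gamma : probability XY R) :=
  forall p : probability XY R, same_marginals p gamma ->
    (transport_cost c gamma <= transport_cost c p)%E.

Lemma optimal_plan_cost_minimal (c : X * Y -> R) (mu : probability (borel X) R)
    (nu : probability (borel Y) R) (gamma : probability XY R) :
  optimal_plan c mu nu gamma -> cost_minimal c gamma.
Proof.
move=> [[gmu gnu] opt] p [p1 p2].
rewrite opt; apply: ereal_inf_lbound; exists p => //.
by split=> [A mA|B mB]; [rewrite -gmu//; exact: p1|rewrite -gnu//; exact: p2].
Qed.

Variables (V : nat -> set Y) (nV : closed_network V).
Variables (f : X * Y -> R) (f0 : forall z, 0 <= f z).
Hypothesis mf : measurable_fun setT (f : XY -> R).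
Variable gamma : probability XY R.
Hypothesis gamma_min : cost_minimal f gamma.
Hypothesis gamma_fin : (transport_cost f gamma < +oo)%E.

Let fE0 z : (0 <= (f z)%:E)%E. Proof. by rewrite lee_fin. Qed.

Let mfE : measurable_fun setT (EFin \o f : XY -> \bar R).
Proof. exact/measurable_EFinP. Qed.

Lemma cost_minimal_part (r a b : {measure set XY -> \bar R}) :
  (forall A, measurable A -> gamma A = r A + a A)%E -> same_marginals b a ->
  (\int[a]_z (f z)%:E <= \int[b]_z (f z)%:E)%E.
Proof.
move=> gra [ba1 ba2].
have bT : b setT = a setT by exact: ba1 measurableT.
have rb1 : measure_add r b setT = 1%E.
  by rewrite measure_addE bT -gra//; exact: probability_setT.
pose p : probability XY R := mnormalize (measure_add r b) gamma.
have pE A : p A = (r A + b A)%E.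
  by rewrite -measure_addE /p /= mnormalize_mass1.
have pgamma : same_marginals p gamma.
  split=> A mA; rewrite pE.
    by rewrite ba1// -gra//; exact: measurable_fst_preimage.
  by rewrite ba2// -gra//; exact: measurable_snd_preimage.
have costD (q : probability XY R) (m : {measure set XY -> \bar R}) :
    (forall A, measurable A -> q A = r A + m A)%E ->
    (transport_cost f q = \int[r]_z (f z)%:E + \int[m]_z (f z)%:E)%E.
  move=> qrm; rewrite -ge0_integral_measure_add//.
  apply: eq_measure_integral => A mA _.
  exact: etrans (qrm A mA) (esym (measure_addE r m A)).
have gammaE := costD gamma a gra.
have := gamma_min pgamma; rewrite gammaE (costD p b)// leeD2lE//.
rewrite ge0_fin_numE ?integral_ge0//; apply: le_lt_trans gamma_fin.
by rewrite gammaE leeDl// integral_ge0.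
Qed.

Lemma cost_minimal_exchange n (s : 'I_n.+1 -> 'I_n.+1) (D : 'I_n.+1 -> set XY)
    (mD : forall i, measurable (D i)) (p : 'I_n.+1 -> probability XY R) :
  injective s -> (forall i, gamma (D i) != 0%E) ->
  (forall i A, measurable A -> p i (borel_fst @^-1` A) =
    conditional gamma (mD i) (borel_fst @^-1` A)) ->
  (forall i B, measurable B -> p i (borel_snd @^-1` B) =
    conditional gamma (mD (s i)) (borel_snd @^-1` B)) ->
  (\sum_i \int[conditional gamma (mD i)]_z (f z)%:E <=
   \sum_i \int[p i]_z (f z)%:E)%E.
Proof.
move=> s_inj D0 p1 p2.
have [k [r [k0 gammaE]]] := conditional_sum_remainder mD D0.
pose scaled_sum (m : 'I_n.+1 -> probability XY R)
  : {measure set XY -> \bar R} := mscale k (ord_msum m).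
have scaled_sumE m A : scaled_sum m A = (k%:num%:E * \sum_i m i A)%E.
  by rewrite /scaled_sum /= /mscale -[in RHS]ord_msumE.
have int_scaled_sum m : (\int[scaled_sum m]_z (f z)%:E =
    k%:num%:E * \sum_i \int[m i]_z (f z)%:E)%E.
  by rewrite ge0_integral_mscale// ge0_integral_ord_msum.
rewrite -(@lee_pmul2l _ k%:num%:E)// -!int_scaled_sum.
apply: (@cost_minimal_part r) => [A mA|]; first by rewrite gammaE// scaled_sumE.
split=> A mA; rewrite !scaled_sumE; congr (_ * _)%E.
  by apply: eq_bigr => i _; exact: p1.
rewrite [RHS](reindex_inj s_inj).
by apply: eq_bigr => i _; exact: p2.
Qed.

Lemma cost_minimal_rectangles n (s : 'I_n.+1 -> 'I_n.+1)
    (E : 'I_n.+1 -> set (borel X)) (F : 'I_n.+1 -> set (borel Y))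
    (l u : 'I_n.+1 -> R) :
  injective s -> (forall i, measurable (E i)) -> (forall i, measurable (F i)) ->
  (forall i, gamma (E i `*` F i) != 0%E) ->
  (forall i x y, E i x -> F i y -> l i <= f (x, y)) ->
  (forall i x y, E i x -> F (s i) y -> f (x, y) <= u i) ->
  \sum_i l i <= \sum_i u i.
Proof.
move=> s_inj mE mF EF0 lf fu.
have mEF i : measurable (E i `*` F i : set XY) by exact: measurable_setX_borel.
pose cond i := conditional gamma (mEF i).
have /choice[p pE] i := independent_coupling
  (distribution (cond i) borel_fst) (distribution (cond (s i)) borel_snd) nV.
have p1 i A : measurable A ->
    p i (borel_fst @^-1` A) = cond i (borel_fst @^-1` A).
  move=> mA; rewrite [in LHS](_ : borel_fst @^-1` A = A `*` setT).
    by rewrite pE// probability_setT mule1.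
  by apply/seteqP; split=> z // [].
have p2 i B : measurable B ->
    p i (borel_snd @^-1` B) = cond (s i) (borel_snd @^-1` B).
  move=> mB; rewrite [in LHS](_ : borel_snd @^-1` B = setT `*` B).
    by rewrite pE// probability_setT mul1e.
  by apply/seteqP; split=> z // [].
rewrite -lee_fin -!sumEFin.
apply: (@le_trans _ _ (\sum_i \int[cond i]_z (f z)%:E)%E).
  apply: lee_sum => i _; apply: (probability_integral_ge (mEF i)) => //.
    by rewrite conditional_superset.
  by move=> [x y] [/= Ex Fy]; exact: lf.
apply: le_trans (cost_minimal_exchange s_inj EF0 p1 p2) _.
apply: lee_sum => i _.
apply: (probability_integral_le (measurable_setX_borel (mE i) (mF (s i)))) =>
  //.
  rewrite pE// /distribution /pushforward /=.
  by rewrite !conditional_superset ?mule1// => z [].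
by move=> [x y] [/= Ex Fy]; exact: fu.
Qed.

End couplings.

(** * Cyclical monotonicity *)

Definition cyclically_monotone (R : realType) (X Y : Type) (c : X * Y -> R)
    (D : set (X * Y)) :=
  forall (n : nat) (s : 'I_n -> 'I_n) (z : 'I_n -> X * Y),
    injective s -> (forall i, D (z i)) ->
    \sum_i c (z i) <= \sum_i c ((z i).1, (z (s i)).2).

Lemma cyclically_monotone_addcst (R : realType) (X Y : Type) (c : X * Y -> R)
    (B : R) (D : set (X * Y)) :
  cyclically_monotone (fun z => c z + B) D -> cyclically_monotone c D.
Proof.
by move=> cmD n s z s_inj Dz; have := cmD n s z s_inj Dz;
  rewrite !big_split/= lerD2r.
Qed.

Lemma continuous_pairl (X Y Z : topologicalType) (x : X) (f : X * Y -> Z) :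
  continuous f -> continuous (fun y => f (x, y)).
Proof.
move=> cf y; apply: continuous_comp; last exact: cf.
by apply: cvg_pair; [exact: cvg_cst|exact: cvg_id].
Qed.

Lemma continuous_pairr (X Y Z : topologicalType) (y : Y) (f : X * Y -> Z) :
  continuous f -> continuous (fun x => f (x, y)).
Proof.
move=> cf x; apply: continuous_comp; last exact: cf.
by apply: cvg_pair; [exact: cvg_id|exact: cvg_cst].
Qed.

Section optimal_plans.
Context {R : realType} {X Y : ptopologicalType}.
Variables (V : nat -> set Y) (nV : closed_network V).

Lemma closed_network_finite_oscillation n (f : X * Y -> R) (x : 'I_n -> X)
    (y0 : Y) (h : R) :
  continuous f -> 0 < h ->
  exists2 k, V k y0 & forall y i, V k y -> `|f (x i, y) - f (x i, y0)| < h.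
Proof.
move=> cf h0.
have near_y0 : \forall y \near y0, forall i, `|f (x i, y) - f (x i, y0)| < h.
  apply: filter_forall => i; have cfx := continuous_pairl (x := x i) cf.
  by have /cvgr_distC_lt/(_ _ h0) := cfx y0.
have [k Vk kU] := nV.2 _ _ (open_interior _) near_y0.
by exists k => // y i /kU/interior_subset.
Qed.

Section nonnegative_cost.
Variables (f : X * Y -> R) (f0 : forall z, 0 <= f z) (cf : continuous f).

Definition cost_slab (t : nat * nat * rat * rat) : set X :=
  let: (k, l, q, r) := t in
  [set x | (forall y, V k y -> ratr q <= f (x, y)) /\
           (forall y, V l y -> f (x, y) <= ratr r)].

Lemma cost_slab_closed t : closed (cost_slab t).
Proof.
case: t => [[[k l] q] r]; rewrite (_ : cost_slab _ =
    (\bigcap_(y in V k) (fun x => f (x, y)) @^-1` [set` `[ratr q, +oo[]) `&`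
    (\bigcap_(y in V l) (fun x => f (x, y)) @^-1` [set` `]-oo, ratr r]])).
  by apply: closedI; apply: closed_bigI => y _; apply: closed_comp;
    [move=> x _; exact: continuous_pairr|exact: interval_closed|
     move=> x _; exact: continuous_pairr|exact: interval_closed].
by apply/seteqP; split=> x [lo up]; split=> y Vy;
  [move: (lo y Vy)|move: (up y Vy)|move: (lo y Vy)|move: (up y Vy)];
  rewrite /= in_itv/= ?andbT.
Qed.

Definition cost_cell (t : nat * nat * rat * rat) : set (borel (X * Y)%type) :=
  cost_slab t `*` V t.1.1.1.

Definition cell_support (gamma : probability (borel (X * Y)%type) R) :
  set (X * Y) :=
  [set z | forall t, cost_cell t z -> gamma (cost_cell t) != 0%E].

Let rational_between (a b : R) : a < b -> exists q : rat, a < ratr q < b.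
Proof.
by move=> /rat_in_itvoo[q]; rewrite in_itv/= => abq; exists q.
Qed.

Lemma cell_support_cyclically_monotone
    (gamma : probability (borel (X * Y)%type) R) :
  cost_minimal f gamma -> (transport_cost f gamma < +oo)%E ->
  cyclically_monotone f (cell_support gamma).
Proof.
move=> gamma_min gamma_fin [|n] s z s_inj Dz; first by rewrite !big_ord0.
apply/ler_addgt0Pr => e e0.
pose h := e / (n.+1%:R *+ 4).
have h0 : 0 < h by rewrite divr_gt0// pmulrn_lgt0.
have /choice[k k_near] (j : 'I_n.+1) : exists k, V k (z j).2 /\
    forall y i, V k y -> `|f ((z i).1, y) - f ((z i).1, (z j).2)| < h.
  have [k Vk kf] := closed_network_finite_oscillation (fst \o z) (z j).2 cf h0.
  by exists k.
have /choice[q q_below] (i : 'I_n.+1) : exists q : rat,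
    f (z i) - h - h < ratr q < f (z i) - h by apply: rational_between; lra.
have /choice[r r_above] (i : 'I_n.+1) : exists r : rat,
    f ((z i).1, (z (s i)).2) + h < ratr r < f ((z i).1, (z (s i)).2) + h + h.
  by apply: rational_between; lra.
pose t i := (k i, k (s i), q i, r i).
have tz i : cost_cell (t i) (z i).
  have /andP[_ ?] := q_below i; have /andP[? _] := r_above i.
  split; last exact: (k_near i).1.
  split=> y /= Vy.
    have := (k_near i).2 y i Vy; rewrite ltr_norml -surjective_pairing.
    by move=> /andP[]; lra.
  by have := (k_near (s i)).2 y i Vy; rewrite ltr_norml => /andP[]; lra.
have qr : \sum_i ratr (q i) <= \sum_i ratr (r i) :> R.
  apply: (cost_minimal_rectangles (E := cost_slab \o t) (F := V \o k) nV f0 _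
    gamma_min gamma_fin s_inj) => //.
  - exact: continuous_measurable_borelR.
  - by move=> i; apply: closed_measurable_borel; exact: cost_slab_closed.
  - by move=> i; exact: closed_network_measurable.
  - by move=> i; exact: Dz (tz i).
  - by move=> i x y [+ _]; exact.
  - by move=> i x y [_ +]; exact.
have f_le_q : \sum_i f (z i) <= \sum_i (ratr (q i) + (h + h)).
  by apply: ler_sum => i _; have /andP[] := q_below i; lra.
have r_le_f : \sum_i ratr (r i) <= \sum_i (f ((z i).1, (z (s i)).2) + (h + h)).
  by apply: ler_sum => i _; have /andP[] := r_above i; lra.
move: f_le_q r_le_f; rewrite !big_split/= !sumr_const card_ord.
have -> : e = h *+ n.+1 *+ 4.
  by rewrite /h -!mulrnA -[RHS]mulr_natr mulfVK// pnatr_eq0.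
by move: (h *+ n.+1) => w; lra.
Qed.

Lemma ae_cell_support (gamma : probability (borel (X * Y)%type) R) :
  {ae gamma, forall z, cell_support gamma z}.
Proof.
pose null t := if gamma (cost_cell t) == 0%E then cost_cell t else set0.
have null0 t : gamma.-negligible (null t).
  rewrite /null; case: ifPn => [/eqP cell0|_]; last exact: negligible_set0.
  apply/negligibleP => //; apply: measurable_setX_borel.
    by apply: closed_measurable_borel; exact: cost_slab_closed.
  exact: closed_network_measurable.
apply: (@negligibleS _ _ _ _ (\bigcup_i oapp null set0 (unpickle i))).
  move=> z /= /existsNP[t /not_implyP[zt /negP]]; rewrite negbK => cell0.
  by exists (pickle t) => //; rewrite pickleK /= /null cell0.
apply: negligible_bigcup => i; case: unpickle => [t|] /=; first exact: null0.
exact: negligible_set0.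
Qed.

End nonnegative_cost.

Lemma optimal_plan_cyclically_monotone (mu : probability (borel X) R)
    (nu : probability (borel Y) R) (c : X * Y -> R) (B : R)
    (gamma : probability (borel (X * Y)%type) R) :
  continuous c -> (forall z, `|c z| <= B) -> optimal_plan c mu nu gamma ->
  exists2 D, cyclically_monotone c D & {ae gamma, forall z, D z}.
Proof.
move=> cc cB /optimal_plan_cost_minimal gamma_min.
have mc : measurable_fun setT (c : borel (X * Y)%type -> R).
  exact: (@continuous_measurable_borelR R (X * Y)%type).
pose f z := c z + B.
have f0 z : 0 <= f z by have := cB z; rewrite ler_norml /f; lra.
have cf : continuous f by move=> z; apply: cvgD; [exact: cc|exact: cvg_cst].
have ic (p : probability (borel (X * Y)%type) R) :
    p.-integrable setT (EFin \o c).
  apply: measurable_bounded_integrable => //.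
    by rewrite [ltLHS]probability_setT ltry.
  exists B; split; first exact: num_real.
  by move=> M /ltW BM z _; exact: le_trans BM.
have costf (p : probability (borel (X * Y)%type) R) :
    transport_cost f p = (transport_cost c p + B%:E)%E.
  rewrite /transport_cost; under eq_integral do rewrite EFinD.
  rewrite integralD//=; last exact: finite_measure_integrable_cst.
  rewrite (integral_cst p measurableT B%:E).
  by rewrite [X in (_ * X)%E](probability_setT p) mule1.
exists (cell_support f gamma).
  apply: (@cyclically_monotone_addcst _ _ _ _ B).
  apply: cell_support_cyclically_monotone => //.
    by move=> p /gamma_min; rewrite !costf leeD2rE.
  by rewrite costf lte_add_pinfty ?ltry//; exact: integrable_lty (ic gamma).
exact: ae_cell_support.
Qed.

End optimal_plans.

(** * c-concave potentials *)

Definition c_superdifferential (R : realType) (X Y : Type) (c : X * Y -> R)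
    (phi : X -> R) : set (X * Y) :=
  [set z | forall x, phi x <= phi z.1 + c (x, z.2) - c z].

Definition c_transform (R : realType) (X Y : Type) (c : X * Y -> R)
    (phi : X -> R) (y : Y) : \bar R :=
  ereal_inf (range (fun x => (c (x, y) - phi x)%:E)).

Section inf_envelope.
Context {R : realType} {X Y : ptopologicalType}.
Variables (c : X * Y -> R) (L : set (Y * R)).

Definition envelope_values (x : X) : set R := [set c (x, l.1) + l.2 | l in L].

Definition inf_envelope (x : X) : R := inf (envelope_values x).

Hypothesis has_envelope : forall x, has_inf (envelope_values x).

Lemma inf_envelope_le x l : L l -> inf_envelope x <= c (x, l.1) + l.2.
Proof. by move=> Ll; apply: ge_inf; [exact: (has_envelope x).2|exists l]. Qed.

Lemma inf_envelope_ge x (b : R) :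
  (forall l, L l -> b <= c (x, l.1) + l.2) -> b <= inf_envelope x.
Proof.
move=> bL; apply: lb_le_inf; first exact: (has_envelope x).1.
by move=> _ [l /bL ? <-].
Qed.

Lemma inf_envelope_adherent x (e : R) : 0 < e ->
  exists2 l, L l & c (x, l.1) + l.2 < inf_envelope x + e.
Proof.
by move=> e0; have [_ [l Ll <-] lt] := inf_adherent e0 (has_envelope x);
  exists l.
Qed.

Lemma inf_envelope_c_concave : c_concave c (EFin \o inf_envelope).
Proof.
split=> //; first by exists point.
exists (c_transform c inf_envelope) => x; apply/eqP; rewrite eq_le.
apply/andP; split.
  apply: le_ereal_inf_tmp => _ [y _ <-] /=.
  have : (c_transform c inf_envelope y <= (c (x, y) - inf_envelope x)%:E)%E.
    by apply: ereal_inf_lbound; exists x.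
  case: (c_transform _ _ y) => [r| |] //=; last by rewrite leey.
  by rewrite lee_fin -EFinB lee_fin; lra.
apply/lee_addgt0Pr => e e0; have [l Ll lt] := inf_envelope_adherent x e0.
have : ((- l.2)%:E <= c_transform c inf_envelope l.1)%E.
  apply: le_ereal_inf_tmp => _ [x' _ <-]; rewrite lee_fin.
  by have := inf_envelope_le x' Ll; lra.
have : (ereal_inf (range
      (fun y => (c (x, y))%:E - c_transform c inf_envelope y))
    <= (c (x, l.1))%:E - c_transform c inf_envelope l.1)%E.
  by apply: ereal_inf_lbound; exists l.1.
move=> /le_trans + lb; apply; case: (c_transform _ _ _) lb => [r|_|//].
  by rewrite lee_fin => lb; rewrite -EFinB -EFinD lee_fin; lra.
by rewrite addeNy leNye.
Qed.

Lemma inf_envelope_superdifferential_closed :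
  continuous c -> closed (c_superdifferential c inf_envelope).
Proof.
move=> cc; rewrite (_ : c_superdifferential _ _ = \bigcap_x \bigcap_(l in L)
    (fun z => c (z.1, l.1) + l.2 + c (x, z.2) - c z) @^-1`
      [set` `[inf_envelope x, +oo[]).
  apply: closed_bigI => x _; apply: closed_bigI => l _.
  apply: closed_comp; last exact: interval_closed.
  move=> z _; apply: cvgB; last exact: cc.
  apply: cvgD; first apply: cvgD; last 2 first.
  - exact: cvg_cst.
  - apply: (@continuous_comp _ _ _ snd (fun y => c (x, y))).
      exact: cvg_snd.
    exact: continuous_pairl.
  - apply: (@continuous_comp _ _ _ fst (fun x => c (x, l.1))).
      exact: cvg_fst.
    exact: continuous_pairr.
apply/seteqP; split=> z zK x => [_ l Ll /=|].
  rewrite in_itv/= andbT; have := zK x; have := inf_envelope_le z.1 Ll; lra.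
suff : inf_envelope x - c (x, z.2) + c z <= inf_envelope z.1 by lra.
apply: inf_envelope_ge => l Ll.
by have := zK x I l Ll; rewrite /= in_itv/= andbT; lra.
Qed.

End inf_envelope.

Section rockafellar.
Context {R : realType} {X Y : ptopologicalType}.
Variables (c : X * Y -> R) (D : set (X * Y)) (z0 : X * Y).

Definition chain_offset (n : nat) (z : nat -> X * Y) : R :=
  \sum_(i < n) c ((z i.+1).1, (z i).2) - \sum_(i < n.+1) c (z i).

Definition chain_ends : set (Y * R) :=
  [set l | exists n z, [/\ z 0%N = z0, forall i, D (z i) &
                           l = ((z n).2, chain_offset n z)]].

Lemma chain_ends_extend y b x' y' : chain_ends (y, b) -> D (x', y') ->
  chain_ends (y', b + c (x', y) - c (x', y')).
Proof.
move=> [n [z [z00 Dz [-> ->]]]] Dxy.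
pose z' i := if (i <= n)%N then z i else (x', y').
have z'n : z' n.+1 = (x', y') by rewrite /z' ltnn.
have z'E i : (i <= n)%N -> z' i = z i by rewrite /z' => ->.
exists n.+1, z'; split=> [||]; first by rewrite z'E.
  by move=> i; rewrite /z'; case: ifP.
have links : \sum_(i < n.+1) c ((z' i.+1).1, (z' i).2) =
    \sum_(i < n) c ((z i.+1).1, (z i).2) + c (x', (z n).2).
  rewrite big_ord_recr /= z'n z'E//; congr (_ + _); apply: eq_bigr => i _.
  by rewrite !z'E// ltnW.
have points : \sum_(i < n.+2) c (z' i) = \sum_(i < n.+1) c (z i) + c (x', y').
  rewrite big_ord_recr /= z'n; congr (_ + _); apply: eq_bigr => i _.
  by rewrite z'E// -ltnS.
by rewrite /chain_offset links points z'n; congr (_, _); ring.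
Qed.

Hypothesis cmD : cyclically_monotone c D.

(* Cyclical monotonicity along the chain closed up at [z0]. *)
Lemma chain_ends_nonneg l : chain_ends l -> 0 <= c (z0.1, l.1) + l.2.
Proof.
move=> [n [z [<- Dz ->]]] /=.
have pred0 : ord_pred (@ord0 n) = n :> nat by rewrite /= modn_small.
have predS (j : 'I_n) : ord_pred (lift (@ord0 n) j) = j :> nat.
  by rewrite [LHS](_ : _ = (j + n.+1) %% n.+1)%N// modnDr modn_small// ltnS
    ltnW.
have := cmD (z := fun i : 'I_n.+1 => z i) (@ord_pred_inj _) (fun i => Dz i).
rewrite [leRHS]big_ord_recl pred0.
under [X in _ <= _ + X]eq_bigr do rewrite predS.
by rewrite /chain_offset /=; lra.
Qed.

Lemma chain_envelope_superdifferential :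
  (forall x, has_inf (envelope_values c chain_ends x)) ->
  D `<=` c_superdifferential c (inf_envelope c chain_ends).
Proof.
move=> has_env [x y] Dxy x' /=.
suff : inf_envelope c chain_ends x' - c (x', y) + c (x, y) <=
    inf_envelope c chain_ends x by lra.
apply: inf_envelope_ge => // -[y' b] yb /=.
by have := inf_envelope_le has_env x' (chain_ends_extend yb Dxy) => /=; lra.
Qed.

End rockafellar.

Lemma cyclically_monotone_potential (R : realType) (X Y : ptopologicalType)
    (c : X * Y -> R) (B : R) (D : set (X * Y)) :
  continuous c -> (forall z, `|c z| <= B) -> cyclically_monotone c D ->
  D !=set0 ->
  exists phi : X -> R, [/\ c_concave c (EFin \o phi),
    closed (c_superdifferential c phi) & D `<=` c_superdifferential c phi].
Proof.
move=> cc cB cmD [z0 Dz0].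
have has_env x : has_inf (envelope_values c (chain_ends c D z0) x).
  split.
    by eexists; exists (z0.2, chain_offset c 0 (fun=> z0)) => //;
      exists 0%N, (fun=> z0).
  exists (- (B + B)) => _ [l /(chain_ends_nonneg cmD) l0 <-].
  have := cB (x, l.1); have := cB (z0.1, l.1).
  by rewrite !ler_norml => /andP[_ ?] /andP[? _]; lra.
exists (inf_envelope c (chain_ends c D z0)); split.
- exact: inf_envelope_c_concave.
- exact: inf_envelope_superdifferential_closed.
- exact: chain_envelope_superdifferential.
Qed.

(** * Differentials and the twist condition *)

Section local_minimum.
Context {R : realType} {V : normedModType R}.

Lemma diff_ge0_at_min (h : V -> R) (a v : V) :
  differentiable h a -> (\forall w \near a, h a <= h w) -> 0 <= 'd h a v.
Proof.
move=> dh hmin; rewrite -deriveE//.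
have dv : derivable h a v by exact: diff_derivable.
rewrite ['D_v h a]cvg_at_rightE//; apply: limr_ge.
  rewrite -(cvg_at_rightE (fun t : R =>
    t^-1 *: ((h \o shift a) (t *: v) - h a)))//.
  apply: cvg_trans dv; apply: cvg_app.
  move=> A [e egt0 Ae]; exists e => // x xe xgt0; apply: Ae => //.
  exact/lt0r_neq0.
have line : (fun t : R => t *: v + a) @ 0^'+ --> a.
  apply: cvg_at_right_filter.
  rewrite -[X in _ --> X]add0r -[X in X + _](scale0r v).
  by apply: cvgD; [apply: cvgZr_tmp|exact: cvg_cst].
near=> t; apply: mulr_ge0; last first.
  by rewrite subr_ge0; near: t; exact: line hmin.
by rewrite invr_ge0 ltW.
Unshelve. all: by end_near. Qed.

Lemma diff_eq_of_touching (f g : V -> R) (a : V) :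
  differentiable f a -> differentiable g a ->
  (\forall w \near a, f w - f a <= g w - g a) -> 'd f a = 'd g a :> (V -> R).
Proof.
move=> df dg fg; apply/funext => v.
have dh : differentiable (g - f) a by exact: differentiableB.
have hmin : \forall w \near a, (g - f) a <= (g - f) w.
  by apply: filterS fg => w; rewrite !fctE; lra.
have dE w : 'd (g - f) a w = 'd g a w - 'd f a w by rewrite diffB.
have := diff_ge0_at_min v dh hmin; have := diff_ge0_at_min (- v) dh hmin.
rewrite !dE !linearN -opprD oppr_ge0 => le0 ge0.
by apply/esym/eqP; rewrite -subr_eq0 eq_le le0.
Qed.

End local_minimum.

Section twist.
Context {R : realType} {n : nat} {X Y : ptopologicalType}.
Variables (S : smooth_atlas R n X) (c : X * Y -> R) (m : nat).
Hypothesis c_twist : m_twist S c m.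

Lemma m_twist_gt0 : (0 < m)%N.
Proof.
rewrite lt0n; apply/eqP => m0.
have := c_twist.2 point point; rewrite m0 II0 card_le0 => /eqP.
by apply/eqP/set0P; exists point.
Qed.

Lemma c_superdifferential_mdiff (phi : X -> R) (x : X) (y : Y) :
  mdifferentiable S phi x -> c_superdifferential c phi (x, y) ->
  mdiff S (fun x => c (x, y)) x = mdiff S phi x.
Proof.
move=> dphi xy; pose a := chart_at S x x.
have aK : chart_inv (chart_at S x) a = x.
  by rewrite chart_mapK ?inE//; exact: chart_at_dom.
apply/esym/diff_eq_of_touching => //; first exact: c_twist.1.
apply: (filterE (F := nbhs a)) => w; rewrite /= aK.
by have := xy (chart_inv (chart_at S x) w); rewrite /=; lra.
Qed.

Lemma c_superdifferential_section_card (phi : X -> R) (x : X) :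
  mdifferentiable S phi x ->
  ([set y | c_superdifferential c phi (x, y)] #<= `I_m)%card.
Proof.
move=> dphi; have [->|/set0P[y0 xy0]] :=
  eqVneq [set y | c_superdifferential c phi (x, y)] set0.
  exact: card_ge0.
apply: card_le_trans (c_twist.2 x y0); apply: subset_card_le => y xy /=.
by rewrite !(c_superdifferential_mdiff dphi).
Qed.

End twist.

(** * Decomposition along graphs *)

Section densities.
Context {d : measure_display} {T : measurableType d} {R : realType}.

Lemma density_of_dominated (mu : {finite_measure set T -> \bar R})
    (m : {measure set T -> \bar R}) :
  (forall A, measurable A -> (m A <= mu A)%E) ->
  exists a : T -> R, [/\ measurable_fun setT a, forall x, 0 <= a x &
    forall A, measurable A -> m A = (\int[mu]_(x in A) (a x)%:E)%E].
Proof.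
move=> m_le; have mT : (m setT < +oo)%E.
  apply: le_lt_trans (m_le _ measurableT) _.
  by rewrite -ge0_fin_numE ?fin_num_measure.
pose mfin : {finite_measure set T -> \bar R} := mfrestr measurableT mT.
have mfinE A : mfin A = m A by rewrite /mfin /= /mfrestr /mrestr setIT.
have dom : mfin `<< mu.
  apply/null_content_dominatesP => A mA muA0; apply/eqP.
  by rewrite -measure_le0 -muA0 [leLHS]mfinE m_le.
pose f := Radon_Nikodym_SigmaFinite.f mfin mu.
have f_fin x : f x \is a fin_num by exact: Radon_Nikodym_SigmaFinite.f_fin_num.
have mf := Radon_Nikodym_SigmaFinite.f_integrable dom.
exists (fine \o f); split=> [|x /=|A mA].
- by apply: measurableT_comp (measurable_int _ mf); exact: fine_measurable.
- by apply: fine_ge0; exact: Radon_Nikodym_SigmaFinite.f_ge0.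
- rewrite -mfinE (Radon_Nikodym_SigmaFinite.f_integral dom)//.
  by apply: eq_integral => x _ /=; rewrite fineK.
Qed.

(* Truncating a density at [1] loses no mass, since [m <= mu] where it exceeds
   [1]. *)
Lemma density_of_dominated_le1 (mu : {finite_measure set T -> \bar R})
    (m : {measure set T -> \bar R}) :
  (forall A, measurable A -> (m A <= mu A)%E) ->
  exists a : T -> R, [/\ measurable_fun setT a, forall x, 0 <= a x <= 1 &
    forall A, measurable A -> m A = (\int[mu]_(x in A) (a x)%:E)%E].
Proof.
move=> m_le; have [a [ma a0 aE]] := density_of_dominated m_le.
pose b x := Num.min (a x) 1.
have mb : measurable_fun setT b.
  by apply: measurable_minr => //; exact: measurable_cst.
have b0 x : 0 <= b x by rewrite /b le_min a0 ler01.
exists b; split=> // [x|A mA]; first by rewrite b0 /b ge_min lexx orbT.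
pose B := a @^-1` `]1, +oo[.
have mB : measurable B by rewrite -[B]setTI; apply: ma.
have mAB : measurable (A `&` B) by exact: measurableI.
have mADB : measurable (A `\` B) by exact: measurableD.
have mE (g : T -> R) E : measurable_fun setT g -> measurable_fun E (EFin \o g).
  by move=> mg; exact/measurable_EFinP/measurable_funTS.
have splitE (g : T -> R) : measurable_fun setT g -> (forall x, 0 <= g x) ->
    (\int[mu]_(x in A) (g x)%:E =
     \int[mu]_(x in A `&` B) (g x)%:E + \int[mu]_(x in A `\` B) (g x)%:E)%E.
  move=> mg g0; rewrite -[in LHS](setUIDK A B) ge0_integral_setU//.
  - exact: mE.
  - by move=> x _; rewrite lee_fin.
  - by apply/disj_setPS => x [[_ Bx] [_ /(_ Bx)]].
apply/eqP; rewrite eq_le aE//; apply/andP; split; last first.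
  apply: ge0_le_integral => //; [|exact: mE|exact: mE|].
    by move=> x _; rewrite lee_fin.
  by move=> x _; rewrite lee_fin /b ge_min lexx.
rewrite !splitE//; apply: leeD.
  rewrite -aE//; apply: le_trans (m_le _ mAB) _.
  rewrite -[leLHS]mul1e -integral_cst//; apply: ge0_le_integral => //.
    exact: mE.
  move=> x [_]; rewrite /B /= in_itv/= andbT lee_fin /b => /ltW ?.
  by rewrite min_r.
apply: ge0_le_integral => //; [|exact: mE|exact: mE|].
  by move=> x _; rewrite lee_fin.
move=> x [_]; rewrite /B /= in_itv/= andbT lee_fin /b => /negP.
by rewrite -leNgt => ?; rewrite min_l.
Qed.

Lemma measure_seqDU_partition (mu : {finite_measure set T -> \bar R})
    (A : nat -> set T) (n : nat) (B : set T) :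
  (forall k, measurable (A k)) -> measurable B ->
  {ae mu, forall x, exists2 k, (k < n)%N & A k x} ->
  mu B = (\sum_(k < n) mu (B `&` seqDU A k))%E.
Proof.
move=> mA mB coverA; pose U := \big[setU/set0]_(k < n) (B `&` seqDU A k).
have mD k : measurable (B `&` seqDU A k).
  by apply: measurableI => //; exact: seqDU_measurable.
have mU : measurable U by apply: bigsetU_measurable => k _.
have UB : U `<=` B.
  by rewrite /U -(bigcup_mkord n (fun k => B `&` seqDU A k)) => x [k _ []].
have BU0 : mu (B `\` U) = 0%E.
  apply/negligibleP; first exact: measurableD.
  apply: negligibleS coverA => x [Bx nUx] [k kn Ax]; apply: nUx.
  have : (\big[setU/set0]_(k < n) seqDU A k) x.
    by rewrite -bigsetU_seqDU -(bigcup_mkord n A); exists k.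
  rewrite -(bigcup_mkord n (seqDU A)) => -[j jn Djx].
  by rewrite /U -(bigcup_mkord n (fun k => B `&` seqDU A k)); exists j.
rewrite (measureDI mu mB mU) [X in (X + _)%E]BU0 add0e setIidr//.
apply: (@measure_semi_additive _ _ _ mu (fun k => B `&` seqDU A k)) => //.
by apply: trivIset_setIl; exact: trivIset_seqDU.
Qed.

End densities.

Lemma ae_sum_densities_eq1 (R : realType) (d : measure_display)
    (T : measurableType d) (mu : probability T R) (n : nat)
    (a : nat -> T -> R) :
  (forall i, measurable_fun setT (a i)) -> (forall i x, 0 <= a i x) ->
  (forall E, measurable E ->
    mu E = (\sum_(i < n) \int[mu]_(x in E) (a i x)%:E)%E) ->
  {ae mu, forall x, \sum_(i < n) a i x = 1}.
Proof.
move=> ma a0 muE.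
have : ae_eq mu setT (cst 1%E) (fun x => (\sum_(i < n) (a i x)%:E)%E).
  apply: integral_ae_eq => //.
  - exact: finite_measure_integrable_cst.
  - by apply: emeasurable_sum => i; exact/measurable_EFinP.
  - move=> E _ mE; rewrite integral_cst// mul1e ge0_integral_sum//.
      exact: muE.
    + by move=> i; apply/measurable_funTS/measurable_EFinP.
    + by move=> i x _; rewrite lee_fin.
by apply: filterS => x /(_ I)/esym; rewrite sumEFin => -[].
Qed.

Section graphs.
Context {R : realType} {X Y : ptopologicalType}.
Variables (V : nat -> set Y) (nV : closed_network V) (hY : hausdorff_space Y).
Variables (mu : probability (borel X) R) (nu : probability (borel Y) R).
Variables (gamma : probability (borel (X * Y)%type) R).
Hypothesis gamma_coupling : couplings mu nu gamma.

Lemma ae_coupling_fst (P : X -> Prop) :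
  {ae mu, forall x, P x} -> {ae gamma, forall z, P z.1}.
Proof.
move=> [N [mN muN0 PN]]; exists (borel_fst @^-1` N); split.
- exact: measurable_fst_preimage.
- by rewrite -muN0 -gamma_coupling.1.
- by move=> z; exact: PN.
Qed.

Lemma ae_coupling_snd (P : Y -> Prop) :
  {ae nu, forall y, P y} -> {ae gamma, forall z, P z.2}.
Proof.
move=> [N [mN nuN0 PN]]; exists (borel_snd @^-1` N); split.
- exact: measurable_snd_preimage.
- by rewrite -nuN0 -gamma_coupling.2.
- by move=> z; exact: PN.
Qed.

Lemma coupling_restriction_density (D : set (borel (X * Y)%type)) :
  measurable D ->
  exists a : borel X -> R, [/\ measurable_fun setT a, forall x, 0 <= a x <= 1 &
    forall A, measurable A ->
      gamma (borel_fst @^-1` A `&` D) = (\int[mu]_(x in A) (a x)%:E)%E].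
Proof.
move=> mD.
apply: (density_of_dominated_le1
  (m := pushforward (mrestr gamma mD) borel_fst)) => // A mA.
rewrite -[leRHS](gamma_coupling.1 _ mA); apply: le_measure; rewrite ?inE.
- by apply: measurableI => //; exact: measurable_fst_preimage.
- exact: measurable_fst_preimage.
- by move=> z [].
Qed.

Lemma coupling_graphs_decomposition (m : nat) (G : nat -> X -> Y) :
  (forall i, measurable_fun setT (G i : borel X -> borel Y)) ->
  {ae gamma, forall z, exists2 i, (i < m)%N & G i z.1 = z.2} ->
  exists alpha : nat -> X -> R,
    [/\ forall i, measurable_fun setT (alpha i : borel X -> R),
        forall i x, 0 <= alpha i x <= 1,
        forall A : set (borel (X * Y)%type), measurable A ->
          gamma A = (\sum_(i < m)
            \int[mu]_x (alpha i x * \1_A (x, G i x))%:E)%E &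
        {ae mu, forall x, \sum_(i < m) alpha i x = 1}].
Proof.
move=> mG Gcover.
pose gr i : set (borel (X * Y)%type) := [set z | G i z.1 = z.2].
have mgr i : measurable (gr i) by exact: measurable_graph nV hY (mG i).
have gammaE A : measurable A ->
    gamma A = (\sum_(i < m) gamma (A `&` seqDU gr i))%E.
  by move=> mA; exact: measure_seqDU_partition.
have /choice[a a_density] i :=
  coupling_restriction_density (seqDU_measurable mgr i).
have ma i : measurable_fun setT (a i) by have [] := a_density i.
have a01 i x : 0 <= a i x <= 1 by have [_ + _] := a_density i.
have aE i A : measurable A -> gamma (borel_fst @^-1` A `&` seqDU gr i) =
    (\int[mu]_(x in A) (a i x)%:E)%E by have [_ _] := a_density i; exact.
exists a; split=> // [A mA|].
  rewrite gammaE//; apply: eq_bigr => i _.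
  have mAG : measurable ([set x | A (x, G i x)] : set (borel X)).
    rewrite -[X in measurable X]setTI.
    by apply: (measurable_fun_pair_borel nV) => //; exact: measurable_id.
  rewrite (_ : A `&` _ = borel_fst @^-1` [set x | A (x, G i x)] `&` seqDU gr i).
    rewrite aE// integral_mkcond; apply: eq_integral => x _.
    rewrite patchE indicE -[x \in _]/((x, G i x) \in A).
    by case: ifP => _; rewrite ?mulr1 ?mulr0.
  apply/seteqP; split=> -[x y] [Axy Dxy]; split => //;
    by have := subset_seqDU Dxy; rewrite /gr /= => Gxy; rewrite -?Gxy// ?Gxy.
apply: ae_sum_densities_eq1 => // [i x|E mE]; first by have /andP[] := a01 i x.
rewrite -gamma_coupling.1// gammaE; last exact: measurable_fst_preimage.
by apply: eq_bigr => i _; exact: aE.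
Qed.

End graphs.

Theorem theorem1p3 (R : realType) (n : nat) (X Y : ptopologicalType)
    (S : smooth_atlas R n X) (g : riemannian_metric S)
    (hX : complete_separable_riemannian g) (hY : polish_space R Y)
    (mu : probability (borel X) R) (nu : probability (borel Y) R)
    (c : X * Y -> R) (hc : continuous c)
    (hb : exists B : R, forall z, `|c z| <= B)
    (m : nat)
    (htwist : m_twist S c m)
    (hatom : non_atomic mu)
    (hdiff : forall phi : X -> \bar R, c_concave c phi ->
       {ae mu, forall x, phi x \is a fin_num -> emdifferentiable S phi x})
    (gamma : probability (borel (X * Y)%type) R)
    (hgamma : optimal_plan c mu nu gamma) :
  exists k : nat, (1 <= k <= m)%N /\
  exists (alpha : 'I_k -> X -> R) (G : 'I_k -> X -> Y),
    [/\ forall i, measurable_fun [set: borel X] (alpha i : borel X -> R),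
        forall i x, 0 <= alpha i x <= 1,
        forall i, measurable_fun [set: borel X] (G i : borel X -> borel Y),
        forall A : set (borel (X * Y)%type), measurable A ->
          gamma A = (\sum_(i < k)
            \int[mu]_x (alpha i x * \1_A (x, G i x))%:E)%E &
        {ae mu, forall x, \sum_(i < k) alpha i x = 1}].
Proof.
have [B cB] := hb; have [V nV] := polish_closed_network hY.
have hausY := polish_hausdorff hY.
have [D cmD aeD] := optimal_plan_cyclically_monotone nV hc cB hgamma.
have [phi [phi_concave phi_closed Dphi]] :=
  cyclically_monotone_potential hc cB cmD (probability_ae_nonempty aeD).
have [F cF aeF] := polish_probability_sigma_compact nu hY.
have [G [mG Gcover]] := finite_multifunction_selection nV hausY m
  (sigma_compact_section_measurable cF phi_closed).
have aeG : {ae gamma, forall z, exists2 i, (i < m)%N & G i z.1 = z.2}.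
  have aedphi := ae_coupling_fst hgamma.1 (hdiff _ phi_concave).
  have aeFy := ae_coupling_snd hgamma.1 aeF.
  apply: (filterS3 (ae_filter_ringOfSetsType gamma) _ aeD aedphi aeFy).
  move=> [x y] Dxy /(_ isT)[_ dphi] Fy.
  apply: Gcover; last by split=> //; exact: Dphi.
  apply: card_le_trans (c_superdifferential_section_card htwist dphi).
  by apply: subset_card_le => z [].
have [alpha [malpha alpha01 gammaE alpha1]] :=
  coupling_graphs_decomposition nV hausY hgamma.1 mG aeG.
exists m; split; first by rewrite leqnn (m_twist_gt0 htwist).
by exists (fun i => alpha i), (fun i => G i); split.
Qed.
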